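(* Let $\mathcal{S}$ be an action-based randomization mechanism, $U$ an uncertainty measure and $p$ a prior on $\mathcal{X}$. Then $I_\star(\mathcal{S},p)\leq I(X;[X])$.
   Context: An action-based randomization mechanism is a 4-tuple $\mathcal{S}=(\mathcal{X},\mathcal{Y},Act,\{M_a:a\in Act\})$ where $\mathcal{X},\mathcal{Y},Act$ are finite nonempty sets and each $M_a$ is a stochastic $|\mathcal{X}|\times|\mathcal{Y}|$ matrix with entries $p_a(y|x)$. An uncertainty measure is a concave continuous function $U:\mathcal{P}\to\mathbb{R}$, $\mathcal{P}$ the set of probability distributions on $\mathcal{X}$. A strategy is a partial function $\sigma:\mathcal{Y}^*\to Act$ with nonempty prefix-closed domain; finite if its domain is finite. The truncation $\sigma\backslash n$ is the restriction of $\sigma$ to sequences of length at most $n$. For a prior $p$ and finite $\sigma$, $p_\sigma$ on $\mathcal{X}\times\mathcal{Y}^*$ is: $p_\sigma(x,\varepsilon)=0$ and $p_\sigma(x,y_1,\dots,y_{j+1})=p(x)\prod_{i=1}^{j+1}p_{a_i}(y_i|x)$ with $a_i=\sigma(y_1\cdots y_{i-1})$ if $y_1\cdots y_j\in\mathrm{dom}(\sigma)$ and $y_1\cdots y_{j+1}\notin\mathrm{dom}(\sigma)$, else $0$. With $(X,Y)\sim p_\sigma$: $I_\sigma(\mathcal{S},p)=U(p)-\sum_{w:\,p_\sigma(w)>0}p_\sigma(w)U(p_\sigma(\cdot|w))$, where $p_\sigma(\cdot|w)$ is the conditional distribution of $X$ given $Y=w$. For infinite $\sigma$, $I_\sigma(\mathcal{S},p)=\lim_{l\to\infty}I_{\sigma\backslash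 l}(\mathcal{S},p)$ (the sequence is nondecreasing). $I_\star(\mathcal{S},p)=\sup_\sigma I_\sigma(\mathcal{S},p)$. Indistinguishability: $x\equiv x'$ iff $p_a(\cdot|x)=p_a(\cdot|x')$ for all $a\in Act$ (equivalently, for every finite strategy the conditional distributions of $Y$ given $X=x$ and $X=x'$ coincide). For an equivalence class $c$ of $\equiv$ let $p(c)=\sum_{x\in c}p(x)$ and, if $p(c)>0$, $p(\cdot|c)$ the distribution equal to $p(x)/p(c)$ on $x\in c$ and $0$ elsewhere. Define $U(X|[X])=\sum_{c:\,p(c)>0}p(c)U(p(\cdot|c))$ and $I(X;[X])=U(p)-U(X|[X])$. *)

(* Defs.v *)
From HB Require Import structures.
From mathcomp Require Import all_boot all_order all_algebra.
From mathcomp Require Import all_classical all_reals all_analysis.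

Set Implicit Arguments.
Unset Strict Implicit.
Unset Printing Implicit Defensive.

Import Order.TTheory GRing.Theory Num.Theory.
Import numFieldNormedType.Exports.

Local Open Scope classical_set_scope.
Local Open Scope ring_scope.

Definition distributions (R : realType) (X : finType) : set (X -> R) :=
  [set p | (forall x, 0 <= p x) /\ \sum_x p x = 1].
Arguments distributions : clear implicits.

(* [kernel a x y] is the entry p_a(y|x). *)
Record mechanism (R : realType) (X Y Act : finType) := Mechanism {
  kernel :> Act -> X -> Y -> R;
  inputs_nonempty : (0 < #|X|)%N;
  outputs_nonempty : (0 < #|Y|)%N;
  actions_nonempty : (0 < #|Act|)%N;
  kernel_stochastic : forall a x, distributions R Y (kernel a x) }.

(* Only the values of [U] on [distributions R X] are meaningful. Functions have
   no canonical topology in the library; since X is finite, pointwise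
   convergence is the usual topology of R^X. *)
Definition uncertainty_measure (R : realType) (X : finType)
    (U : (X -> R) -> R) : Prop :=
  convex_function (distributions R X) (fun p => - U p) /\
  {within (distributions R X : set {ptws X -> R}),
    continuous (U : {ptws X -> R} -> R)}.

Section Strategies.
Variables Y Act : finType.

Definition dom (s : seq Y -> option Act) : set (seq Y) := [set w | isSome (s w)].

Record strategy := Strategy {
  strategy_fun :> seq Y -> option Act;
  strategy_dom_nonempty : dom strategy_fun !=set0;
  strategy_dom_prefix : forall v w,
    prefix v w -> dom strategy_fun w -> dom strategy_fun v }.

Definition truncate_fun (s : seq Y -> option Act) (n : nat) (w : seq Y) :=
  if (size w <= n)%N then s w else None.

Fact truncate_dom_nonempty (s : strategy) n : dom (truncate_fun s n) !=set0.
Proof.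
exists [::]; rewrite /dom /truncate_fun /=.
have [w sw] := strategy_dom_nonempty s.
exact: strategy_dom_prefix (prefix0s w) sw.
Qed.

Fact truncate_dom_prefix (s : strategy) n v w :
  prefix v w -> dom (truncate_fun s n) w -> dom (truncate_fun s n) v.
Proof.
rewrite /dom /truncate_fun /= => vw; case: ifP => // wn sw.
rewrite (leq_trans (size_prefix vw) wn); exact: strategy_dom_prefix vw sw.
Qed.

Definition truncate (s : strategy) (n : nat) : strategy :=
  Strategy (@truncate_dom_nonempty s n) (@truncate_dom_prefix s n).

End Strategies.

Section Information.
Variables (R : realType) (X Y Act : finType) (S : mechanism R X Y Act).
Variables (U : (X -> R) -> R) (p : X -> R).

(* The i-th factor (counting from 0) is p_a(y|x), where y is the i-th letter
   of w and a is the action chosen after the first i letters; the default 0 is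
   never reached when [s] is a strategy defined on [take (size w).-1 w]. *)
Definition path_prob (s : seq Y -> option Act) (w : seq Y) (x : X) : R :=
  \prod_(i < size w)
    oapp (fun a => S a x (tnth (in_tuple w) i)) 0 (s (take i w)).

Definition joint (s : strategy Y Act) (x : X) (w : seq Y) : R :=
  if [&& w != [::], isSome (s (take (size w).-1 w)) & ~~ isSome (s w)]
  then p x * path_prob s w x else 0.

Definition marginal (s : strategy Y Act) (w : seq Y) : R :=
  \sum_x joint s x w.

Definition posterior (s : strategy Y Act) (w : seq Y) : X -> R :=
  fun x => joint s x w / marginal s w.

(* For a finite strategy the sum has finitely many nonzero terms. *)
Definition info_finite (s : strategy Y Act) : R :=
  U p - \sum_(w \in [set w | 0 < marginal s w])
          marginal s w * U (posterior s w).

Definition info (s : strategy Y Act) : R :=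
  if `[< finite_set (dom s) >] then info_finite s
  else lim (info_finite (truncate s l) @[l --> \oo]).

(* The supremum is taken in the extended reals, so that it is a genuine least
   upper bound without presupposing boundedness. *)
Definition info_star : \bar R := ereal_sup (range (fun s => (info s)%:E)).

Definition indist : rel X :=
  [rel x x' | [forall a, forall y, S a x y == S a x' y]].

Definition indist_classes : {set {set X}} :=
  equivalence_partition indist [set: X]%SET.

Definition class_prob (c : {set X}) : R := \sum_(x in c) p x.

Definition class_cond (c : {set X}) : X -> R :=
  fun x => if x \in c then p x / class_prob c else 0.

Definition uncertainty_given_class : R :=
  \sum_(c in indist_classes | 0 < class_prob c) class_prob c * U (class_cond c).

Definition info_class : R := U p - uncertainty_given_class.

End Information.

(* Main.v *)
(** Extend [U] to nonnegative measures by H(m) = |m| U(m/|m|), which is positively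
    homogeneous and, by concavity of [U], superadditive. For a finite strategy,
    the uncertainty remaining after the observation is the sum of H(joint(., w))
    over the leaves [w]. Splitting each joint(., w) along the classes [c] of
    indistinguishability can only decrease this sum; and since q_w(x) = P(w | x)
    is constant on [c], the piece on [c] is q_w(c) times the restriction of the
    prior to [c]. As the q_w(c) add up to 1 over [w], the split sum is exactly
    U(X | [X]). *)

Require Import Defs.
From HB Require Import structures.
From mathcomp Require Import all_boot all_order all_algebra.
From mathcomp Require Import all_classical all_reals all_analysis.

Set Implicit Arguments.
Unset Strict Implicit.
Unset Printing Implicit Defensive.

Import Order.TTheory GRing.Theory Num.Theory.
Import numFieldNormedType.Exports.

Local Open Scope classical_set_scope.
Local Open Scope ring_scope.

(** * The homogeneous extension of a concave function to nonnegative measures *)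

Section Perspective.
Variables (R : realType) (X : finType).
Implicit Types (U : (X -> R) -> R) (m : X -> R).

Definition mass m : R := \sum_x m x.

(** The function H of the introduction. If the mass is 0, the quotient is not a distribution, but
    the factor [mass m] makes the value 0. *)
Definition perspective U m : R := mass m * U (fun x => m x / mass m).

Lemma mass_eq0 m x : (forall x, 0 <= m x) -> mass m = 0 -> m x = 0.
Proof. by move=> m0 /psumr_eq0P; apply. Qed.

Lemma normalize_distribution m : (forall x, 0 <= m x) -> 0 < mass m ->
  distributions R X (fun x => m x / mass m).
Proof.
move=> m0 M0; split=> [x|]; first by rewrite divr_ge0// ltW.
by rewrite -mulr_suml divff// gt_eqF.
Qed.

Lemma perspectiveZ U (t : R) m :
  perspective U (fun x => t * m x) = t * perspective U m.
Proof.
rewrite /perspective /mass -mulr_sumr.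
have [->|t0] := eqVneq t 0; first by rewrite !mul0r.
rewrite mulrA; congr (_ * U _); apply/funext => x.
by rewrite -mulf_div divff// mul1r.
Qed.

(** The normalization of [m + m'] is the convex combination of those of [m] and [m'], with weights
    proportional to their masses; multiply concavity of [U] by the total mass. A nonnegative measure
    of mass 0 vanishes, which settles the degenerate cases. *)
Lemma perspective_superadditive U m m' :
  convex_function (distributions R X) (fun p => - U p) ->
  (forall x, 0 <= m x) -> (forall x, 0 <= m' x) ->
  perspective U m + perspective U m' <= perspective U (m + m').
Proof.
move=> cU m0 m'0.
have massD : mass (m + m') = mass m + mass m' by rewrite -big_split.
have M0 : 0 <= mass m by exact: sumr_ge0.
have M'0 : 0 <= mass m' by exact: sumr_ge0.
have [Me|Mn] := eqVneq (mass m) 0.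
  rewrite {1}/perspective Me mul0r add0r.
  suff -> : m + m' = m' by [].
  by apply/funext => x /=; rewrite /GRing.add /= mass_eq0// add0r.
have [M'e|M'n] := eqVneq (mass m') 0.
  rewrite {2}/perspective M'e mul0r addr0.
  suff -> : m + m' = m by [].
  by apply/funext => x /=; rewrite /GRing.add /= (mass_eq0 x m'0 M'e) addr0.
have {M0} Mp : 0 < mass m by rewrite lt_neqAle eq_sym Mn.
have {M'0} M'p : 0 < mass m' by rewrite lt_neqAle eq_sym M'n.
have sp : 0 < mass m + mass m' by rewrite addr_gt0.
have sn : mass m + mass m' != 0 by rewrite gt_eqF.
set t := mass m / (mass m + mass m').
have t0 : 0 <= t by rewrite divr_ge0// ltW.
have t1 : t <= 1 by rewrite ler_pdivrMr// mul1r lerDl ltW.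
have tN : 1 - t = mass m' / (mass m + mass m').
  by rewrite -[1](divff sn) -mulrBl [_ + _ - _]addrC addKr.
have := cU (@Itv01 R t t0 t1) _ _
  (mem_set (normalize_distribution m0 Mp))
  (mem_set (normalize_distribution m'0 M'p)).
rewrite convRE /= /unstable.onem tN.
rewrite !mulrN -opprD lerN2.
move=> /(ler_wpM2l (ltW sp)).
have scaleK a b : (mass m + mass m') * (a / (mass m + mass m') * b) = a * b.
  by rewrite mulrA [_ * (a / _)]mulrC divfK.
rewrite mulrDr !scaleK.
move=> /le_trans; apply.
rewrite {1}/perspective massD le_eqVlt; apply/orP; left; apply/eqP.
congr (_ * U _); apply/funext => x.
transitivity (t * (m x / mass m) + (1 - t) * (m' x / mass m')); first by [].
have cancel a b : a != 0 -> a / (mass m + mass m') * (b / a) =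
    b / (mass m + mass m') by move=> a0; rewrite mulrC mulrA divfK.
by rewrite tN /t !cancel// -mulrDl.
Qed.

Lemma perspective_sum U (I : Type) (r : seq I) (P : pred I) (F : I -> X -> R) :
  convex_function (distributions R X) (fun p => - U p) ->
  (forall i x, P i -> 0 <= F i x) ->
  \sum_(i <- r | P i) perspective U (F i) <=
  perspective U (fun x => \sum_(i <- r | P i) F i x).
Proof.
move=> cU F0.
(* Superadditivity needs nonnegative measures, so nonnegativity of the partial sums is carried
   through the induction. *)
suff [_] : (forall x, 0 <= (\sum_(i <- r | P i) F i) x) /\
    \sum_(i <- r | P i) perspective U (F i) <=
    perspective U (\sum_(i <- r | P i) F i).
  by congr (_ <= perspective U _); apply/funext => x; rewrite fct_sumE.
elim/big_rec2: _ => [|i s m Pi [m0 sm]].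
  by split=> //; rewrite /perspective /mass big1 ?mul0r.
split=> [x|]; first by rewrite addr_ge0// F0.
apply: le_trans (perspective_superadditive cU _ m0) => [|x]; last exact: F0.
by rewrite lerD2l.
Qed.

Definition restriction (c : {set X}) m : X -> R :=
  fun x => if x \in c then m x else 0.

(** Each point lies in exactly one block, so [m] is the sum of its restrictions and superadditivity
    applies. *)
Lemma perspective_partition U (P : {set {set X}}) m :
  convex_function (distributions R X) (fun p => - U p) ->
  finset.partition P [set: X]%SET -> (forall x, 0 <= m x) ->
  \sum_(c in P) perspective U (restriction c m) <= perspective U m.
Proof.
move=> cU pP m0; apply: le_trans (perspective_sum _ _ _) _ => //.
  by move=> c x _; rewrite /restriction; case: ifP.
rewrite le_eqVlt; apply/orP; left; apply/eqP; congr perspective.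
apply/funext => x; have xP : x \in finset.cover P by rewrite (finset.cover_partition pP) inE.
have [_ tP _] := and3P pP.
rewrite (bigD1 (finset.pblock P x)) ?finset.pblock_mem//= /restriction finset.mem_pblock xP.
rewrite big1 ?addr0// => c /andP[cP cx]; case: ifP => // xc.
by move: cx; rewrite (finset.def_pblock tP cP xc) eqxx.
Qed.

End Perspective.

(** * Enumeration of words of bounded length *)

Section Words.
Variable Y : finType.

Fixpoint words n : seq (seq Y) :=
  if n is n'.+1 then [seq rcons w y | w <- words n', y <- enum Y] else [:: [::]].

Lemma size_words n w : w \in words n -> size w = n.
Proof.
elim: n w => [|n IH] w /=; first by rewrite inE => /eqP ->.
by move=> /allpairsP[[v y] [/= /IH <- _ ->]]; rewrite size_rcons.
Qed.

Lemma mem_words w : w \in words (size w).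
Proof.
elim/last_ind: w => [|w y IH] //; rewrite size_rcons /=.
by apply/allpairsP; exists (w, y); rewrite mem_enum.
Qed.

Lemma words_uniq n : uniq (words n).
Proof.
elim: n => [|n IH] //=; apply: allpairs_uniq => //; first exact: enum_uniq.
by move=> [v y] [v' y'] _ _ /= /rcons_inj[-> ->].
Qed.

(** Lengths start at 1 because the empty word is never a leaf. *)
Definition words_upto n := [seq w | k <- iota 1 n, w <- words k].

Lemma words_upto_uniq n : uniq (words_upto n).
Proof.
apply: allpairs_uniq_dep; [exact: iota_uniq|by move=> k _; exact: words_uniq|].
move=> _ _ /allpairsPdep[k [w [_ wk ->]]] /allpairsPdep[k' [w' [_ wk' ->]]] /= e.
by move: wk wk'; rewrite e => /size_words <- /size_words <-.
Qed.

Lemma mem_words_upto n w : w != [::] -> (size w <= n)%N -> w \in words_upto n.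
Proof.
move=> w0 wn; apply/allpairsPdep; exists (size w), w; split=> //.
- by rewrite mem_iota add1n ltnS wn lt0n size_eq0 w0.
- exact: mem_words.
Qed.

End Words.

(** * The strategy as a tree: leaves and their conditional probabilities *)

Section StrategyTree.
Variables (R : realType) (X Y Act : finType) (S : mechanism R X Y Act).
Implicit Types s : strategy Y Act.

Definition leaf s (w : seq Y) :=
  [&& w != [::], isSome (s (take (size w).-1 w)) & ~~ isSome (s w)].

(** The conditional probability of ending at [w] given the input [x]: [joint] without its prior
    factor. *)
Definition leaf_prob s w x := if leaf s w then path_prob S s w x else 0.

Lemma joint_leaf p s x w : joint S p s x w = p x * leaf_prob s w x.
Proof. by rewrite /joint /leaf_prob /leaf; case: ifP; rewrite ?mulr0. Qed.

Lemma path_prob_rcons s w y x :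
  path_prob S s (rcons w y) x =
  path_prob S s w x * oapp (fun a => S a x y) 0 (s w).
Proof.
have path_probE v : path_prob S s v x =
    \prod_(i < size v) oapp (fun a => S a x (nth y v i)) 0 (s (take i v)).
  by apply: eq_bigr => i _; case: (s _) => //= a; rewrite (tnth_nth y).
rewrite !path_probE size_rcons big_ord_recr /=; congr (_ * _).
  by apply: eq_bigr => i _; rewrite nth_rcons ltn_ord -cats1 takel_cat// ltnW.
by rewrite nth_rcons ltnn eqxx -cats1 take_size_cat.
Qed.

Lemma path_prob_ge0 s w x : 0 <= path_prob S s w x.
Proof.
apply: prodr_ge0 => i _; case: (s _) => //= a.
by have [+ _] := kernel_stochastic S a x; apply.
Qed.

Lemma leaf_prob_ge0 s w x : 0 <= leaf_prob s w x.
Proof. by rewrite /leaf_prob; case: ifP => // _; exact: path_prob_ge0. Qed.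

Lemma leaf_rcons s w y :
  leaf s (rcons w y) = isSome (s w) && ~~ isSome (s (rcons w y)).
Proof.
by rewrite /leaf size_rcons /= -[in take _ _]cats1 take_size_cat//; case: w.
Qed.

(** A child of a domain word is either in the domain or a leaf, and the row of the chosen action
    sums to 1. If [w] is outside the domain, so are its children by prefix closure, and none of them
    is a leaf. *)
Lemma leaf_prob_step s w x :
  \sum_y ((if isSome (s (rcons w y)) then path_prob S s (rcons w y) x else 0) +
          leaf_prob s (rcons w y) x) =
  if isSome (s w) then path_prob S s w x else 0.
Proof.
have step y : (if isSome (s (rcons w y)) then path_prob S s (rcons w y) x else 0)
    + leaf_prob s (rcons w y) x =
    path_prob S s w x * oapp (fun a => S a x y) 0 (s w).
  rewrite /leaf_prob leaf_rcons path_prob_rcons.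
  have := @strategy_dom_prefix _ _ s w (rcons w y); rewrite /dom /=.
  rewrite -cats1 prefix_prefix => /(_ isT).
  case: (s w) => [a|]; case: (s (w ++ _)) => [b|] //=.
  - by rewrite addr0.
  - by rewrite add0r.
  - by move=> /(_ isT).
  - by rewrite mulr0 addr0.
under eq_bigr do rewrite step.
rewrite -mulr_sumr; case: (s w) => [a|] /=; last by rewrite big1 ?mulr0.
by have [_ ->] := kernel_stochastic S a x; rewrite mulr1.
Qed.

(** Conservation of probability: after [n] observations the run has either stopped at a leaf or
    reached a domain word of length [n]. *)
Lemma leaf_prob_sum_upto s n x :
  \sum_(w <- words_upto Y n) leaf_prob s w x +
  \sum_(w <- words Y n) (if isSome (s w) then path_prob S s w x else 0) = 1.
Proof.
rewrite /words_upto big_allpairs_dep /=.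
elim: n => [|n IH].
  rewrite big_nil add0r big_seq1.
  have [w sw] := strategy_dom_nonempty s.
  have -> : isSome (s [::]) by exact: strategy_dom_prefix (prefix0s w) sw.
  by rewrite /path_prob big_ord0.
have -> : iota 1 n.+1 = rcons (iota 1 n) n.+1.
  by rewrite -[n.+1 in LHS]addn1 iotaD add1n cats1.
rewrite -cats1 big_cat big_seq1 -addrA.
rewrite -{}[RHS]IH; congr (_ + _).
rewrite !big_allpairs_dep addrC -big_split /=; apply: eq_bigr => w _.
by rewrite -big_split /= big_enum leaf_prob_step.
Qed.

(** The bound is strict because a leaf is one letter longer than a domain word; leaves then have
    length at most [n]. *)
Definition depth_lt s n := forall w, dom s w -> (size w < n)%N.

Lemma leaf_prob_sum s n x : depth_lt s n ->
  \sum_(w <- words_upto Y n) leaf_prob s w x = 1.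
Proof.
move=> sn; rewrite -(leaf_prob_sum_upto s n x) [X in _ + X]big1_seq ?addr0//.
move=> w /= /size_words wn; case: ifP => // /sn.
by rewrite wn ltnn.
Qed.

Lemma leaf_words_upto s n w : depth_lt s n -> leaf s w -> w \in words_upto Y n.
Proof.
move=> sn /and3P[w0 sw _]; apply: mem_words_upto => //.
have := sn _ sw; rewrite size_takel ?leq_pred//.
by case: w w0 {sw}.
Qed.

Lemma depth_lt_truncate s n : depth_lt (truncate s n) n.+1.
Proof. by move=> w; rewrite /dom /= /truncate_fun; case: ifP. Qed.

Lemma finite_depth s : finite_set (dom s) -> exists n, depth_lt s n.
Proof.
move=> /finite_seqP[r domE]; exists (\max_(w <- r) size w).+1 => w.
by rewrite domE => wr; rewrite ltnS; exact: leq_bigmax_seq.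
Qed.

Lemma indist_classes_partition : finset.partition (indist_classes S) [set: X]%SET.
Proof.
apply: finset.equivalence_partitionP => x y z _ _ _; split.
  by apply/forallP => a; apply/forallP.
move=> /forallP xy; apply/forallP/forallP => h a; apply/forallP => b.
  by rewrite -(eqP (forallP (xy a) b)); exact: (forallP (h a) b).
by rewrite (eqP (forallP (xy a) b)); exact: (forallP (h a) b).
Qed.

(** Whether [w] is a leaf does not depend on the input, and the kernel factors agree on
    indistinguishable inputs. *)
Lemma leaf_prob_class s w c x y : c \in indist_classes S ->
  x \in c -> y \in c -> leaf_prob s w x = leaf_prob s w y.
Proof.
move=> /imsetP[z _ ->]; rewrite !inE /= => /forallP zx /forallP zy.
rewrite /leaf_prob; case: ifP => // _; apply: eq_bigr => i _.
case: (s _) => //= a; set b := tnth _ _.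
by rewrite -(eqP (forallP (zx a) b)) (eqP (forallP (zy a) b)).
Qed.

End StrategyTree.

(** * The bound for strategies of finite depth *)

Section Bound.
Variables (R : realType) (X Y Act : finType) (S : mechanism R X Y Act).
Variables (U : (X -> R) -> R) (p : X -> R).
Hypotheses (cU : convex_function (distributions R X) (fun p => - U p)).
Hypothesis (hp : distributions R X p).

Lemma joint_ge0 s x w : 0 <= joint S p s x w.
Proof.
by have [p0 _] := hp; rewrite joint_leaf mulr_ge0// leaf_prob_ge0.
Qed.

Lemma perspective_prior : perspective U p = U p.
Proof.
have [_ p1] := hp; rewrite /perspective /mass p1 mul1r.
by congr U; apply/funext => x; rewrite divr1.
Qed.

(** Classes of probability 0 may be included, since their perspective is 0. *)
Lemma uncertainty_given_classE :
  uncertainty_given_class S U p =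
  \sum_(c in indist_classes S) perspective U (restriction c p).
Proof.
have [p0 _] := hp.
rewrite /uncertainty_given_class big_mkcondr /=; apply: eq_bigr => c _.
have mc : mass (restriction c p) = class_prob p c by rewrite /class_prob big_mkcond.
rewrite /perspective mc; case: ifP => [c0|].
  congr (_ * U _); apply/funext => x; rewrite /class_cond /restriction.
  by case: ifP; rewrite ?mul0r.
rewrite lt_neqAle sumr_ge0// andbT => /negbFE/eqP <-.
by rewrite mul0r.
Qed.

(** Words of positive marginal are leaves, hence listed in [words_upto]; the other listed words have
    marginal 0 and contribute nothing. *)
Lemma info_finiteE s n : depth_lt s n ->
  info_finite S U p s =
  U p - \sum_(w <- words_upto Y n) perspective U (joint S p s ^~ w).
Proof.
move=> sn; congr (_ - _); symmetry.
rewrite fsbig_seq ?words_upto_uniq//; symmetry; apply: fsbig_widen.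
  move=> w /= mw; apply: (leaf_words_upto sn).
  apply: contraTT mw => wl; rewrite /marginal big1 ?ltxx// => x _.
  by rewrite joint_leaf /leaf_prob (negbTE wl) mulr0.
move=> w [_ /= /negP]; rewrite lt_neqAle negb_and => /orP[|].
  by rewrite negbK => /eqP m0; rewrite -m0 mul0r.
by rewrite sumr_ge0// => x _; exact: joint_ge0.
Qed.

Lemma info_finite_le s n : depth_lt s n ->
  info_finite S U p s <= info_class S U p.
Proof.
move=> sn; rewrite (info_finiteE sn) /info_class lerD2l lerN2.
rewrite uncertainty_given_classE.
have classE c : c \in indist_classes S ->
    perspective U (restriction c p) =
    \sum_(w <- words_upto Y n) perspective U (restriction c (joint S p s ^~ w)).
  move=> cS; have [_ _ n0] := and3P (indist_classes_partition S).
  have /set0Pn[x xc] : c != finset.set0 by apply: contraNneq n0 => <-.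
  (* On [c] the leaf probability equals its value at the representative [x], so homogeneity pulls it
     out; these factors sum to 1 over the words. *)
  have jointE w : restriction c (joint S p s ^~ w) =
      (fun y => leaf_prob S s w x * restriction c p y).
    apply/funext => y; rewrite /restriction; case: ifP => yc; last by rewrite mulr0.
    by rewrite joint_leaf mulrC (leaf_prob_class s w cS xc yc).
  under eq_bigr do rewrite jointE perspectiveZ.
  by rewrite -mulr_suml (leaf_prob_sum S x sn) mul1r.
rewrite (eq_bigr _ classE) exchange_big; apply: ler_sum => w _ /=.
apply: perspective_partition => //; first exact: indist_classes_partition.
by move=> x; exact: joint_ge0.
Qed.

(** Splitting the prior itself along the classes can only decrease its perspective, which is
    [U p]. *)
Lemma info_class_ge0 : 0 <= info_class S U p.
Proof.
rewrite subr_ge0 uncertainty_given_classE -perspective_prior.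
apply: perspective_partition => //; first exact: indist_classes_partition.
by case: hp.
Qed.

End Bound.

Theorem theorem5p3 (R : realType) (X Y Act : finType)
    (S : mechanism R X Y Act) (U : (X -> R) -> R) (p : X -> R)
    (hU : uncertainty_measure U) (hp : distributions R X p) :
  (info_star S U p <= (info_class S U p)%:E)%E.
Proof.
have [cU _] := hU.
apply: ge_ereal_sup => _ [s _ <-]; rewrite lee_fin /info.
case: asboolP => [/finite_depth[n sn]|_]; first exact: info_finite_le sn.
have [cv|ncv] := pselect (cvgn (fun l => info_finite S U p (truncate s l))).
  (* Every truncation has finite depth, so the bound holds termwise and passes to the limit. *)
  apply: limr_le cv _; apply: nearW => l.
  exact: info_finite_le (@depth_lt_truncate _ _ s l).
(* The sequence does converge, but this need not be proved: otherwise [lim]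
   would have the junk value 0, which is also below the bound. *)
rewrite (dvgP ncv); exact: info_class_ge0.
Qed.
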